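(* Let $C_n$ denote the cycle with $n$ vertices. Then $$I'(C_{n})=I''(C_{n})=\begin{cases}\frac{n}{2}, & \text{if } n \text{ is even and } n\geq 8,\\ \frac{n+3}{2}, & \text{if } n\text{ is odd and } n\geq 13.\end{cases}$$
   Context: For a finite simple undirected graph $H$ with vertex set $V(H)$ and $v\in V(H)$, $B_H(v)=\{u\in V(H): d_H(u,v)\leq 1\}$, where $d_H$ is the distance in $H$. A code is a nonempty set of vertices. A code $C$ separates two distinct vertices $x,y$ if $B_H(x)\cap C\neq B_H(y)\cap C$. $I'(H)$ denotes the minimum cardinality of a code $C'\subseteq V(H)$ that separates every pair of distinct vertices of $H$. $I''(H)$ denotes the minimum cardinality of a code $C''\subseteq V(H)$ that separates every pair of distinct vertices of $H$ and satisfies $C''\not\subseteq B_H(v)$ for every $v\in V(H)$. The cycle $C_n$ of order $n$ has vertex set $\mathbb{Z}_n$ and edges $\{i,i+1\}$ for $i\in\mathbb{Z}_n$. *)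

(* Defs.v *)
From HB Require Import structures.
From mathcomp Require Import all_boot all_order all_algebra.

Set Implicit Arguments.
Unset Strict Implicit.
Unset Printing Implicit Defensive.

Record sgraph := SGraph {
  vertex :> finType;
  edge : rel vertex;
  edge_sym : symmetric edge;
  edge_irr : irreflexive edge
}.

(* Least length of a walk from u to v.  A shortest walk has length < #|H|, so
   the value #|H| is only taken when v is not reachable from u; then
   #|H| >= 2, so such a v lies outside the ball of radius 1. *)
Definition dist (H : sgraph) (u v : H) : nat :=
  find (fun k => [exists p : k.-tuple H, path (@edge H) u p && (last u p == v)])
       (iota 0 #|H|).

Definition ball (H : sgraph) (v : H) : {set H} := [set u | dist u v <= 1].

Definition separates (H : sgraph) (C : {set H}) (x y : H) : bool :=
  ball x :&: C != ball y :&: C.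

Definition separating_code (H : sgraph) (C : {set H}) : bool :=
  (C != set0) && [forall x : H, forall y : H, (x != y) ==> separates C x y].

Definition unbounded_code (H : sgraph) (C : {set H}) : bool :=
  [forall v : H, ~~ (C \subset ball v)].

(* None when no set satisfies P: for instance no code separates two vertices
   with the same ball. *)
Definition min_card (T : finType) (P : pred {set T}) : option nat :=
  if [pick C | P C] is Some C0 then Some #|[arg min_(C < C0 | P C) #|C|]|
  else None.

(* I'(H) *)
Definition Iprime (H : sgraph) : option nat :=
  min_card (@separating_code H).

(* I''(H) *)
Definition Isecond (H : sgraph) : option nat :=
  min_card (fun C : {set H} => separating_code C && unbounded_code C).

Section Cycle.
Local Open Scope ring_scope.
Variable n : nat.

Definition cycle_edge : rel 'Z_n :=
  fun i j => (j == i + 1) || (i == j + 1).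

Lemma cycle_edge_sym : symmetric cycle_edge.
Proof. by move=> i j; rewrite /cycle_edge orbC. Qed.

Lemma cycle_edge_irr : irreflexive cycle_edge.
Proof.
by move=> i; rewrite /cycle_edge orbb -[X in X == _]GRing.addr0
  (inj_eq (GRing.addrI i)) eq_sym GRing.oner_eq0.
Qed.

(* The cycle of order n for n >= 3 ('Z_n is Z/nZ only when n >= 2). *)
Definition cycle_graph : sgraph := SGraph cycle_edge_sym cycle_edge_irr.

End Cycle.

(* Main.v *)
Require Import Defs.
From mathcomp Require Import all_boot all_algebra zify.

Set Implicit Arguments.
Unset Strict Implicit.
Unset Printing Implicit Defensive.

Import GRing.Theory.

(** The balls of radius 1 around two neighbours x + 1, x + 2 of the cycle
    differ exactly in x and x + 3, so a separating code C meets every pair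
    {x, x + 3} ([separating_gap3]). It also leaves at most one ball empty
    ([separating_ball_disjoint]). Conversely, a code that meets every pair
    {x, x + 3} and every ball is separating ([gap3_separating]).

    Counting the pairs {x, x + 3} gives 2|C| = n + |E|, where E is the set of
    the x with both x and x + 3 in C ([gap3_card]). Hence |C| >= n / 2. For odd
    n the number |E| is odd, and the bound (n + 3) / 2 means that |E| = 1 is
    impossible. If E = {e}, read C as the 0-1 sequence c starting at e: going
    from k to k + 3 flips c for 0 < k < n, so c has period 6 on the window
    1, ..., n + 2, and closing up the cycle determines c. Either it cannot close
    up (n divisible by 3), or each period of c has three consecutive zeros
    ([antiperiodic3_gaps]). For n >= 13 two such blocks fit in the window, and
    their midpoints are two vertices with the same empty trace on C.

    The bounds are attained by the even residues, to which 1 is added when n is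
    odd since the pair {n - 2, 1} would otherwise be missed. Such a code has
    more than three elements, so no ball contains it and I' and I'' agree. *)

(** * Minimum cardinalities and balls *)

Lemma min_cardP (T : finType) (P : pred {set T}) (k : nat) :
  (exists2 C, P C & #|C| = k) -> (forall C, P C -> k <= #|C|) ->
  min_card P = Some k.
Proof.
move=> [C PC cardC] lbk; rewrite /min_card.
case: pickP => [C0 PC0|/(_ C)]; last by rewrite PC.
case: arg_minnP => // D PD minD; congr Some.
by apply/eqP; rewrite eqn_leq lbk // -cardC minD.
Qed.

(** [dist] searches the walk lengths 0, ..., #|H| - 1, so the length 1 is not
    tried when #|H| = 1; there the two vertices coincide. *)
Lemma mem_ball (H : sgraph) (u v : H) : (u \in ball v) = (u == v) || edge u v.
Proof.
rewrite inE /dist; set Q := (fun k : nat => _).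
have Q0 : Q 0 = (u == v).
  apply/existsP/eqP => [[p]|->]; first by rewrite tuple0 => /eqP.
  by exists [tuple]; rewrite /= eqxx.
have Q1 : Q 1 = edge u v.
  apply/existsP/idP => [[p]|uv].
    by case/tupleP: p => w q; rewrite tuple0 /= andbT => /andP[uv /eqP <-].
  by exists [tuple v]; rewrite /= uv eqxx.
case E: #|H| => [|[|k]].
- by have := fintype0 u E.
- have /fintype_le1P/(_ v) uv : #|H| <= 1 by rewrite E.
  by rewrite /= Q0 uv eqxx.
- by rewrite /= Q0 Q1; case: (u == v); case: (edge u v).
Qed.

(** * Sequences flipped by a shift of 3 *)

(** From position 1 on, c repeats the window a, b, 1, ~a, ~b, 0. The shift by n
    is compared with this window at 0 and 1; the residue of n modulo 6 decides
    the outcome. *)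
Lemma antiperiodic3_gaps (n : nat) (c : nat -> bool) :
  odd n -> 13 <= n -> (forall k, c (k + n) = c k) -> c 0 -> c 3 ->
  (forall k, 0 < k < n -> c (k + 3) = ~~ c k) ->
  exists p, [/\ ~~ c p, ~~ c p.+1 & ~~ c p.+2] /\
            [/\ ~~ c (p + 6), ~~ c (p + 6).+1 & ~~ c (p + 6).+2].
Proof.
move=> oddn n13 per c0 c3 alt.
have alt6 i k : 0 < k -> k + 6 * i < n + 3 -> c (k + 6 * i) = c k.
  move=> k0; elim: i => [|i IH] lt; first by rewrite addn0.
  rewrite -IH; last by lia.
  have -> : k + 6 * i.+1 = k + 6 * i + 3 + 3 by lia.
  by rewrite !alt ?negbK //; clear -lt k0; lia.
have c6 : ~~ c 6 by rewrite (alt 3) ?c3 //; clear -n13; lia.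
have c4 : c 4 = ~~ c 1 by rewrite (alt 1) //; clear -n13; lia.
have c5 : c 5 = ~~ c 2 by rewrite (alt 2) //; clear -n13; lia.
have cn0 := per 0; have cn1 := per 1; rewrite add0n in cn0.
pose q := n %/ 6.
have : [|| n == 6 * q + 1, n == 6 * q + 3 | n == 6 * q + 5].
  by rewrite /q; clear -oddn; lia.
move: q => q /or3P[] /eqP En.
(* n = 6q + 1: the window is 1, 1, 1, 0, 0, 0. *)
- have c1 : c 1.
    rewrite (_ : c 1 = c 0) // -cn0 -(alt6 q 1) //; [congr c|];
    by clear -n13 En; lia.
  have c2 : c 2.
    rewrite (_ : c 2 = c 1) // -cn1 -(alt6 q 2) //; [congr c|];
    by clear -n13 En; lia.
  exists 4; rewrite c4 c5 c1 c2; split; split=> //.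
  + by rewrite (alt6 1 4) ?c4 ?c1 //; clear -n13 En; lia.
  + by rewrite (alt6 1 5) ?c5 ?c2 //; clear -n13 En; lia.
  + by rewrite (alt6 1 6) //; clear -n13 En; lia.
(* n = 6q + 3: the shift by n contradicts the antiperiodicity at 1. *)
- have : c 4 = c 1.
    by rewrite -cn1 -(alt6 q 4) //; [congr c|]; clear -n13 En; lia.
  by rewrite c4; case: (c 1).
(* n = 6q + 5: the window is 0, 0, 1, 1, 1, 0, and here n >= 17. *)
- have c2 : ~~ c 2.
    rewrite -c5 (_ : c 5 = c 0) // -cn0 -(alt6 q 5) //; [congr c|];
    by clear -n13 En; lia.
  have c1 : ~~ c 1.
    rewrite (_ : c 1 = c 6) // -cn1 -(alt6 q 6) //; [congr c|];
    by clear -n13 En; lia.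
  have c7 : ~~ c 7 by rewrite (alt6 1 1) //; clear -n13 En; lia.
  have c8 : ~~ c 8 by rewrite (alt6 1 2) //; clear -n13 En; lia.
  exists 6; split; split=> //.
  + by rewrite (alt6 1 6) //; clear -n13 En; lia.
  + by rewrite (alt6 1 7) //; clear -n13 En; lia.
  + by rewrite (alt6 1 8) //; clear -n13 En; lia.
Qed.

(** * Separating codes of the cycle *)

Section Cycle.

Local Open Scope ring_scope.

Variable n : nat.
Hypothesis n_gt4 : (4 < n)%N.

Local Notation G := (cycle_graph n).
Implicit Types (C : {set 'Z_n}) (x y z : 'Z_n).

Let n_gt1 : (1 < n)%N. Proof. by lia. Qed.

Lemma eq_shift x (a b : nat) : (x + a%:R == x + b%:R) = (a == b %[mod n])%N.
Proof. by rewrite (inj_eq (addrI x)) -val_eqE /= !val_Zp_nat. Qed.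

Lemma shift_mod x (a : nat) : x + (a + n)%:R = x + a%:R.
Proof. by apply/eqP; rewrite eq_shift modnDr. Qed.

(** Writing the centre as x + k.+1 puts the three elements at increasing natural
    offsets from one base point, so that they are compared by [eq_shift]. *)
Lemma mem_ball_cycle x (k : nat) u :
  (u \in @ball G (x + k.+1%:R)) =
  [|| u == x + k%:R, u == x + k.+1%:R | u == x + k.+2%:R].
Proof.
rewrite mem_ball /= /cycle_edge.
have -> : x + k.+1%:R = x + k%:R + 1 by rewrite -addrA natr1.
have -> : x + k.+2%:R = x + k%:R + 1 + 1 by rewrite -!addrA -!natr1 -!addrA.
by rewrite (inj_eq (addIr 1)) (eq_sym _ u) orbCA.
Qed.

Lemma separating_gap3 C : @separating_code G C ->
  forall x, (x \in C) || (x + 3%:R \in C).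
Proof.
case/andP=> _ /forallP sepC x; apply/norP=> -[xC x3C].
have /implyP := forallP (sepC (x + 1%:R)) (x + 2%:R).
rewrite eq_shift !modn_small //; last by lia.
move/(_ isT)/eqP; apply; apply/setP => u; rewrite !in_setI !mem_ball_cycle.
have [uC|_] := boolP (u \in C); last by rewrite !andbF.
have /negPf -> : u != x + 0%:R by rewrite addr0; apply: contraNneq xC => <-.
have /negPf -> : u != x + 3%:R by apply: contraNneq x3C => <-.
by rewrite orbF.
Qed.

Lemma separating_ball_disjoint C : @separating_code G C ->
  forall x y : G, [disjoint ball x & C] -> [disjoint ball y & C] -> x = y.
Proof.
case/andP=> _ /forallP sepC x y; rewrite -!setI_eq0 => /eqP bx /eqP by_.
apply: contraTeq (forallP (sepC x) y) => ->.
by rewrite /separates bx by_ eqxx.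
Qed.

(** Of the balls around x and x + d, only the first contains x - 1 and only the
    second contains x + 2, since n > 4; C contains one of these two vertices. *)
Lemma gap3_separates C x (d : nat) : (0 < d < 3)%N ->
  (forall x, (x \in C) || (x + 3%:R \in C)) -> @separates G C x (x + d%:R).
Proof.
move=> d12 gapC; rewrite -(subrK 1%:R x); move: (x - 1%:R) => {}x.
rewrite -addrA -natrD add1n; apply/eqP => /setP eqC.
case/orP: (gapC x) => uC.
- have := eqC (x + 0%:R).
  rewrite !in_setI !mem_ball_cycle !eq_shift !modn_small ?addr0 ?uC; lia.
- have := eqC (x + 3%:R).
  rewrite !in_setI !mem_ball_cycle !eq_shift uC !modn_small; lia.
Qed.

(** Two balls with the same nonempty trace on C share a vertex u, so their
    centres lie among u - 1, u, u + 1 and differ by 1 or 2. *)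
Lemma gap3_separating C : (forall x, (x \in C) || (x + 3%:R \in C)) ->
  (forall x : G, exists2 u : G, u \in ball x & u \in (C : {set G})) ->
  @separating_code G C.
Proof.
move=> gapC domC; apply/andP; split.
  by apply/set0Pn; case/orP: (gapC 0) => ?; eexists; eassumption.
apply/forallP => x; apply/forallP => y; apply/implyP => neq_xy.
apply/eqP => eqC.
have [u ux uC] := domC x.
have uy : u \in ball y.
  by have /setP/(_ u) := eqC; rewrite !in_setI ux uC !andbT => <-.
have shift (v : G) : u \in ball v ->
    exists2 k : nat, (k < 3)%N & v = u - 1 + k%:R.
  rewrite mem_ball /= => /or3P[] /eqP ->.
  - by exists 1%N; rewrite // subrK.
  - by exists 2; rewrite // -nat1r addrA subrK.
  - by exists 0%N; rewrite // addrK addr0.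
wlog [a [b [ab b3 Ex Ey]]] : x y neq_xy eqC ux uy / exists a b : nat,
    [/\ (a < b)%N, (b < 3)%N, x = u - 1 + a%:R & y = u - 1 + b%:R].
  move=> wlg; have [a a3 Ex] := shift x ux; have [b b3 Ey] := shift y uy.
  case: (ltngtP a b) => ab.
  - by apply: (wlg x y) => //; exists a, b.
  - by apply: (wlg y x) => //; [rewrite eq_sym | exists b, a].
  - by case/eqP: neq_xy; rewrite Ex Ey ab.
have d12 : (0 < b - a < 3)%N by lia.
move: (u - 1) Ex Ey => z Ex Ey.
have := gap3_separates (z + a%:R) d12 gapC.
by rewrite -addrA -natrD subnKC ?(ltnW ab) // -Ex -Ey /separates eqC eqxx.
Qed.

(** Each vertex lies in two of the pairs {x, x + 3}, and each pair meets C once,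
    or twice when x is in the set on the right. *)
Lemma gap3_card C : (forall x, (x \in C) || (x + 3%:R \in C)) ->
  (#|C|.*2 = n + #|[set x in C | (x + 3%:R)%R \in C]|)%N.
Proof.
move=> gapC; pose ind x : nat := x \in C.
have cardC : #|C| = (\sum_x ind x)%N by rewrite -sum1_card big_mkcond.
have cardC' : #|C| = (\sum_x ind (x + 3%:R)%R)%N.
  by rewrite cardC (reindex_inj (addIr 3%:R)).
have cardZ : #|'Z_n| = n by rewrite card_ord Zp_cast.
rewrite -addnn {1}cardC cardC' -big_split /= -[X in (X + _)%N]cardZ.
rewrite -!sum1_card [X in _ = (_ + X)%N]big_mkcond -big_split /=.
apply: eq_bigr => x _; rewrite inE /ind; have := gapC x.
by case: (x \in C) => //= ->.
Qed.

Lemma unbounded_of_card C : (3 < #|C|)%N -> @unbounded_code G C.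
Proof.
move=> C3; apply/forallP => v; apply: contraL C3 => sCv; rewrite -leqNgt.
rewrite -(subrK 1%:R v : _ = v) in sCv; move: (v - 1%:R) sCv => x sCx.
apply: leq_trans (card_size [:: x + 0%:R; x + 1%:R; x + 2%:R]).
apply/subset_leq_card/subsetP => u /(subsetP sCx).
by rewrite mem_ball_cycle !inE.
Qed.

Lemma separating_card_lb C : @separating_code G C -> (n <= #|C|.*2)%N.
Proof. by move/separating_gap3/gap3_card->; rewrite leq_addr. Qed.

Lemma odd_separating_card_lb C : odd n -> (13 <= n)%N ->
  @separating_code G C -> (n + 3 <= #|C|.*2)%N.
Proof.
move=> odd_n n13 sepC; have gapC := separating_gap3 sepC.
have := gap3_card gapC; set E := [set x in C | _] => cardE.
(* |E| has the parity of n, so only |E| = 1 has to be excluded. *)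
suff : #|E| != 1%N by lia.
apply/cards1P => -[e defE].
have inE' x : (x \in C) && (x + 3%:R \in C) = (x == e + 0%:R).
  by have /setP/(_ x) := defE; rewrite !inE addr0.
pose c k := e + k%:R \in C.
have /andP[c0 c3] : c 0%N && c 3 by rewrite /c addr0 inE' addr0.
have [||p [[p0 p1 p2] [p6 p7 p8]]] :=
  @antiperiodic3_gaps n c odd_n n13 _ c0 c3.
- by move=> k; rewrite /c shift_mod.
- move=> k k_lt; have := gapC (e + k%:R); have := inE' (e + k%:R).
  rewrite eq_shift !modn_small; [|lia..].
  rewrite -addrA -natrD -/(c k) -/(c (k + 3)%N).
  have -> : (k == 0)%N = false by lia.
  by case: (c k); case: (c _).
have empty q : ~~ c q -> ~~ c q.+1 -> ~~ c q.+2 ->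
    [disjoint @ball G (e + q.+1%:R) & C].
  move=> q0 q1 q2; apply/pred0P => u; apply/negbTE/negP => /andP[].
  rewrite /= mem_ball_cycle => /or3P[] /eqP -> uC.
  - by case/negP: q0.
  - by case/negP: q1.
  - by case/negP: q2.
have := separating_ball_disjoint sepC (empty _ p0 p1 p2) (empty _ p6 p7 p8).
move/eqP; rewrite eq_shift -addSn -[X in X == _ %[mod n]]addn0.
by rewrite eqn_modDl !modn_small //; clear -n13; lia.
Qed.

(** * Codes attaining the bounds *)

Definition parity_code : {set 'Z_n} :=
  [set x : 'Z_n | ~~ odd x || odd n && (x == 1 :> nat)].

Lemma val_add3 x : x + 3%:R = (if x + 3 < n then x + 3 else x + 3 - n)%N :> nat.
Proof.
have x_lt : (x < n)%N by rewrite -[X in (_ < X)%N]Zp_cast.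
rewrite -[X in (X + _)%R]natr_Zp -natrD val_Zp_nat //.
case: ltnP => x3; first by rewrite modn_small.
by rewrite -{1}(subnK x3) modnDr modn_small //; lia.
Qed.

Lemma parity_code_gap3 x : (x \in parity_code) || (x + 3%:R \in parity_code).
Proof.
have x_lt : (x < n)%N by rewrite -[X in (_ < X)%N]Zp_cast.
by rewrite !inE val_add3; case: ifP; lia.
Qed.

Lemma parity_code_separating : @separating_code G parity_code.
Proof.
apply: gap3_separating parity_code_gap3 _ => x.
have x_lt : (x < n)%N by rewrite -[X in (_ < X)%N]Zp_cast.
have [odd_x|even_x] := boolP (odd x); last first.
  by exists x; rewrite ?mem_ball ?eqxx // inE even_x.
exists x.-1%:R; last by rewrite inE val_Zp_nat // modn_small; lia.
by rewrite mem_ball /= /cycle_edge natr1 prednK ?natr_Zp ?eqxx ?orbT //; lia.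
Qed.

Lemma card_parity_code : #|parity_code| = (uphalf n + odd n)%N.
Proof.
pose P b (i : nat) := ~~ odd i || b && (i == 1%N).
have sumP b m : (\sum_(0 <= i < m) P b i = uphalf m + (b && (1 < m)))%N.
  elim: m => [|m IH]; first by rewrite big_nil andbF.
  by rewrite big_nat_recr //= IH /P; case: (b); lia.
rewrite -sum1_card big_mkcond /=.
transitivity (\sum_(0 <= i < n) P (odd n) i)%N; last first.
  by rewrite sumP n_gt1 andbT.
rewrite -[X in index_iota _ X](Zp_cast n_gt1) big_mkord.
by apply: eq_bigr => x _; rewrite inE -/(P _ _); case: (P _ _).
Qed.

End Cycle.

Theorem proposition2p4 (n : nat) :
  (~~ odd n -> 8 <= n ->
     Iprime (cycle_graph n) = Some (n %/ 2) /\
     Isecond (cycle_graph n) = Some (n %/ 2)) /\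
  (odd n -> 13 <= n ->
     Iprime (cycle_graph n) = Some ((n + 3) %/ 2) /\
     Isecond (cycle_graph n) = Some ((n + 3) %/ 2)).
Proof.
have main k : 7 < n -> #|parity_code n| = k ->
    (forall C : {set 'Z_n},
       @separating_code (cycle_graph n) C -> k <= #|C|) ->
    Iprime (cycle_graph n) = Some k /\ Isecond (cycle_graph n) = Some k.
  move=> n8 cardE lb; have n4 : 4 < n by lia.
  have sepE := parity_code_separating n4.
  split; apply: min_cardP.
  - by exists (parity_code n).
  - exact: lb.
  - exists (parity_code n); rewrite // sepE unbounded_of_card //.
    by rewrite card_parity_code //; lia.
  - by move=> C /andP[/lb].
split=> [even_n n8 | odd_n n13]; apply: main; rewrite ?card_parity_code; try lia.
- have n4 : 4 < n by lia.
  by move=> C /(separating_card_lb n4); lia.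
- have n4 : 4 < n by lia.
  by move=> C /(odd_separating_card_lb n4 odd_n n13); lia.
Qed.
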